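(* Let $k\ge 1$ be an integer. There are only finitely many $k$-tuples of integers $(a_1,\dots,a_k)$ for which there exist distinct nonzero integers $n_1,n_2,\dots,n_{k-1}$ such that $$f(z)=a_1z^{n_1}+\cdots+a_{k-1}z^{n_{k-1}}+a_k$$ is not identically zero and satisfies $M(f)=1$.
   Context: For a nonzero (Laurent) polynomial $f$ in one variable with complex coefficients, the Mahler measure is $M(f)=\exp\left(\int_0^1\log|f(e^{2\pi i t})|\,dt\right)$. *)

(* Defs.v *)
From HB Require Import structures.
From mathcomp Require Import all_boot all_order all_algebra.
From mathcomp Require Import complex.
From mathcomp Require Import all_classical all_reals all_analysis.

Set Implicit Arguments.
Unset Strict Implicit.
Unset Printing Implicit Defensive.

Import Order.TTheory GRing.Theory Num.Theory.

Local Open Scope ring_scope.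
Local Open Scope classical_set_scope.
Local Open Scope complex_scope.

Definition expi2pi (R : realType) (t : R) : R[i] :=
  cos (2 * pi * t) +i* sin (2 * pi * t).

(* Since lne 0 = -oo and expeR -oo = 0, no convention is needed at the zeros
   of f on the circle, and the zero function has Mahler measure 0. *)
Definition mahler (R : realType) (f : R[i] -> R[i]) : \bar R :=
  (expeR (\int[lebesgue_measure]_(t in `[0%R, 1%R])
            lne (Normc.normc (f (expi2pi t)))%:E))%E.

(* a_1 z^(n_1) + ... + a_(k-1) z^(n_(k-1)) + a_k, the tuples being indexed
   from 0.  The exponents may be negative: this is meant for z != 0 only. *)
Definition laurent (R : realType) (k : nat) (a : k.-tuple int)
    (n : k.-1.-tuple int) (z : R[i]) : R[i] :=
  (\sum_(i < k.-1) (a`_i)%:~R * z ^ n`_i) + (a`_k.-1)%:~R.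

(* Main.v *)
Require Import Defs.
From HB Require Import structures.
From mathcomp Require Import all_boot all_order all_algebra.
From mathcomp Require Import complex.
From mathcomp Require Import ring lra zify.
From mathcomp Require Import all_classical all_reals all_analysis.
From mathcomp Require Import measurable_realfun.

(* For p = c prod (X - a) put M(p) = |c| prod max(1, |a|).  Jensen's formula on
   circles of radius r > 1, r -> 1, shows that M(p) is at most the Mahler measure
   of p, and that M(p) <= M(q) if |p| <= |q| outside the unit disc.  Reflecting
   the outer roots of p into the disc and comparing derivatives (Bernstein,
   Gauss-Lucas) gives M(p') <= deg(p) M(p).  If p has k + 1 terms, then every
   coefficient is at most 2^k M(p) in modulus, by induction on k: divide out X,
   and reverse p if necessary to put the coefficient into the upper half of the
   degrees; differentiation then removes the constant term and costs a factor 2.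
   Hence Mahler measure 1 bounds the coefficients in terms of k alone. *)

Set Implicit Arguments.
Unset Strict Implicit.
Unset Printing Implicit Defensive.

Import Order.TTheory GRing.Theory Num.Theory.
Import numFieldNormedType.Exports.

Local Open Scope ring_scope.
Local Open Scope classical_set_scope.
Local Open Scope complex_scope.

Local Notation normc := Normc.normc.

(** * Reflecting roots into the unit disc *)

Section RootNorms.
Context {R : realType}.
Local Notation C := R[i].
Implicit Types (z a c : C) (s t : seq C) (p : {poly C}).

Lemma normc_normr z : (normc z)%:C = `|z|. Proof. by case: z. Qed.

Lemma normc_ge0 z : 0 <= normc z.
Proof. by rewrite -lecR normc_normr normr_ge0. Qed.

Lemma normc_gt0 z : (0 < normc z) = (z != 0).
Proof. by rewrite -ltcR normc_normr normr_gt0. Qed.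

Lemma normc_conj z : normc z^* = normc z.
Proof. by case: z => x y /=; rewrite sqrrN. Qed.

Lemma normc_opp z : normc (- z) = normc z.
Proof. by case: z => x y /=; rewrite !sqrrN. Qed.

Lemma normc_inv z : normc z^-1 = (normc z)^-1.
Proof. by apply: complexI; rewrite fmorphV !normc_normr normfV. Qed.

Lemma normc_prod (I : Type) (r : seq I) (F : I -> C) :
  normc (\prod_(i <- r) F i) = \prod_(i <- r) normc (F i).
Proof.
by apply: (big_morph _ (@Normc.normcM R)); exact: Normc.normc1.
Qed.

Lemma normc_real (x : R) : normc x%:C = `|x|.
Proof. by rewrite /= expr0n /= addr0 sqrtr_sqr. Qed.

Lemma normc_natr n : normc (n%:R : C) = n%:R.
Proof. by rewrite -(rmorph_nat (real_complex R)) normc_real normr_nat. Qed.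

Definition poly_roots c s : {poly C} := c *: \prod_(a <- s) ('X - a%:P).

(** By Jensen's formula this is the Mahler measure of [poly_roots c s] on the circle of radius [r];
    [r = 1] gives the M(p) of the introduction. *)
Definition root_measure (r : R) c s : R :=
  normc c * \prod_(a <- s) Num.max r (normc a).

Lemma horner_poly_roots c s z :
  (poly_roots c s).[z] = c * \prod_(a <- s) (z - a).
Proof.
rewrite /poly_roots hornerZ horner_prod; congr (_ * _).
by apply: eq_bigr => a _; rewrite !hornerE.
Qed.

Lemma poly_roots_exists p : exists t, p = poly_roots (lead_coef p) t.
Proof.
have [t ->] := closed_field_poly_normal p; exists t.
by rewrite lead_coefZ lead_coef_prod_XsubC mulr1.
Qed.

Lemma lead_coef_poly_roots c s : lead_coef (poly_roots c s) = c.
Proof. by rewrite lead_coefZ (monicP _) ?mulr1 ?monic_prod_XsubC. Qed.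

Lemma size_poly_roots c s : c != 0 -> size (poly_roots c s) = (size s).+1.
Proof. by move=> c0; rewrite size_scale// size_prod_XsubC. Qed.

Lemma deriv_poly_roots c s z : z \notin s ->
  (poly_roots c s)^`().[z] =
  (poly_roots c s).[z] * \sum_(a <- s) (z - a)^-1.
Proof.
rewrite /poly_roots derivZ !hornerZ -mulrA => zs; congr (_ * _).
elim: s zs => [|a s IH]; first by rewrite !big_nil derivC hornerC mulr0.
rewrite in_cons negb_or => /andP[za /IH {}IH].
rewrite !big_cons derivM derivXsubC mul1r hornerD !hornerM IH hornerXsubC.
rewrite mulrDr mulrAC divff ?mul1r ?subr_eq0//.
by rewrite !mulrA.
Qed.

Lemma Re_div_gt0 z a : normc a < normc z -> 0 < complex.Re (z / (z - a)).
Proof.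
move=> az.
have za : z - a != 0.
  by rewrite subr_eq0; apply: contraTneq az => ->; rewrite ltxx.
suff -> : complex.Re (z / (z - a)) =
    complex.Re (z * (z - a)^*) / normc (z - a) ^+ 2.
  rewrite divr_gt0 ?exprn_gt0 ?normc_gt0//.
  have : complex.Re (z * a^*) < normc z ^+ 2.
    have /le_lt_trans : complex.Re (z * a^*) <= normc z * normc a.
      rewrite -(normc_conj a) -Normc.normcM -lecR normc_normr.
      apply: le_trans (normc_ge_Re _); rewrite lecR.
      exact: ler_norm.
    by apply; rewrite expr2 ltr_pM2l// (le_lt_trans _ az)// normc_ge0.
  rewrite -subr_gt0; congr (_ < _).
  case: z {az za} => x y; case: a => u v /=.
  by rewrite sqr_sqrtr ?addr_ge0 ?sqr_ge0//; ring.
case: z az za => x y; case: a => u v /= az za.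
rewrite sqr_sqrtr ?addr_ge0 ?sqr_ge0//.
have : (x - u) ^+ 2 + (y - v) ^+ 2 != 0.
  apply: contra za; rewrite paddr_eq0 ?sqr_ge0// !sqrf_eq0 eq_complex /=.
  by [].
by move=> ?; field.
Qed.

(** The logarithmic derivative gives z p'(z) / p(z) = sum of z / (z - a) over the roots, and every
    summand has positive real part when |a| <= 1 < |z|. *)
Lemma Gauss_Lucas c s z : c != 0 -> s != [::] ->
  {in s, forall a, normc a <= 1} -> 1 < normc z ->
  (poly_roots c s)^`().[z] != 0.
Proof.
move=> c0 s0 s1 z1.
have zs : z \notin s by apply: contraTN z1 => /s1; rewrite leNgt.
rewrite deriv_poly_roots// mulf_neq0//.
  rewrite horner_poly_roots mulf_neq0// prodf_seq_neq0.
  by apply/allP => a aS /=; rewrite subr_eq0; apply: contraNneq zs => ->.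
apply/negP => /eqP S0.
have : 0 < complex.Re (\sum_(a <- s) z / (z - a)).
  rewrite raddf_sum /=.
  case: s s0 s1 {zs S0} => // a s _ s1; rewrite big_cons ltr_wpDr//.
    rewrite big_seq sumr_ge0// => b bs.
    by rewrite ltW// Re_div_gt0// (le_lt_trans _ z1)// s1// inE bs orbT.
  by rewrite Re_div_gt0// (le_lt_trans _ z1)// s1// inE eqxx.
by rewrite -mulr_sumr S0 mulr0 ltxx.
Qed.

Definition reflect_coef a : C := if normc a <= 1 then 1 else - a^*.
Definition reflect_root a : C := if normc a <= 1 then a else (a^*)^-1.

Lemma normc_reflect_coef a : normc (reflect_coef a) = Num.max 1 (normc a).
Proof.
rewrite /reflect_coef; case: leP => _; first by rewrite Normc.normc1.
by rewrite normc_opp normc_conj.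
Qed.

Lemma normc_reflect_root a : normc (reflect_root a) <= 1.
Proof.
rewrite /reflect_root; case: (leP (normc a) 1) => // a1.
by rewrite normc_inv normc_conj invf_le1 ?ltW// (lt_trans ltr01 a1).
Qed.

(** For |a| > 1 this is the identity |1 - a^* z|^2 - |z - a|^2 = (|z|^2 - 1) (|a|^2 - 1), whose
    right side is nonnegative. *)
Lemma reflect_le z a : 1 <= normc z ->
  normc (z - a) <= normc (reflect_coef a) * normc (z - reflect_root a).
Proof.
move=> z1; rewrite -Normc.normcM /reflect_coef /reflect_root.
case: (leP (normc a) 1) => [_|a1]; first by rewrite mul1r.
have a0 : a^* != 0.
  by rewrite -normc_gt0 normc_conj (lt_trans ltr01 a1).
have -> : - a^* * (z - (a^*)^-1) = 1 - a^* * z by field.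
have: 0 <= (normc z ^+ 2 - 1) * (normc a ^+ 2 - 1).
  by rewrite mulr_ge0// subr_ge0 expr_ge1// ?normc_ge0// ltW.
case: z {z1} => x y; case: a {a0 a1} => u v /=.
rewrite !sqr_sqrtr ?addr_ge0 ?sqr_ge0// => h.
by rewrite ler_sqrt ?addr_ge0 ?sqr_ge0//; nra.
Qed.

Definition reflect_lead c s := c * \prod_(a <- s) reflect_coef a.

Lemma normc_reflect_lead c s : normc (reflect_lead c s) = root_measure 1 c s.
Proof.
rewrite Normc.normcM normc_prod; congr (_ * _).
by apply: eq_bigr => a _; rewrite normc_reflect_coef.
Qed.

Lemma le_root_measure c s : normc c <= root_measure 1 c s.
Proof.
rewrite ler_peMr ?normc_ge0//.
elim/big_rec: _ => // a x _ x1; rewrite -[leLHS]mulr1.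
by rewrite ler_pM// le_max lexx.
Qed.

Lemma reflect_poly_le c s z : 1 <= normc z ->
  normc (poly_roots c s).[z] <=
  normc (poly_roots (reflect_lead c s) (map reflect_root s)).[z].
Proof.
move=> z1; rewrite !horner_poly_roots big_map !Normc.normcM !normc_prod -mulrA.
rewrite ler_wpM2l ?normc_ge0// -big_split /=.
by apply: ler_prod => a _; rewrite normc_ge0 reflect_le.
Qed.

(* Bernstein's comparison: for |lambda| > 1 the polynomial f - lambda g has no
   zero in |z| > 1, hence by Gauss-Lucas neither has f' - lambda g'. *)
Lemma deriv_reflect_le c s z : c != 0 -> s != [::] -> 1 < normc z ->
  normc (poly_roots c s)^`().[z] <=
  normc (poly_roots (reflect_lead c s) (map reflect_root s))^`().[z].
Proof.
move=> c0 s0 z1.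
set f := poly_roots c s; set g := poly_roots _ _.
have g0 : reflect_lead c s != 0.
  rewrite -normc_gt0 normc_reflect_lead.
  by rewrite (lt_le_trans _ (le_root_measure _ _)) ?normc_gt0.
have in1 : {in map reflect_root s, forall a, normc a <= 1}.
  by move=> _ /mapP[a _ ->]; exact: normc_reflect_root.
have gz : g^`().[z] != 0 by apply: Gauss_Lucas => //; case: s s0 {f g g0 in1}.
rewrite leNgt; apply/negP => fg.
(* This lambda makes the derivative of f - lambda g vanish at [z], and the assumption |f'(z)| >
   |g'(z)| gives |lambda| > 1. *)
pose l := f^`().[z] / g^`().[z].
have l1 : 1 < normc l.
  by rewrite Normc.normcM normc_inv ltr_pdivlMr ?normc_gt0// mul1r.
pose h := f - l *: g.
have h_root w : 1 < normc w -> h.[w] != 0.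
  move=> w1; rewrite hornerD hornerN (hornerZ l) subr_eq0.
  have /lt_eqF/negbT : normc f.[w] < normc (l * g.[w]).
    rewrite Normc.normcM.
    apply: (le_lt_trans (reflect_poly_le c s (ltW w1))).
    rewrite -/g ltr_pMl// normc_gt0 horner_poly_roots mulf_neq0//.
    rewrite prodf_seq_neq0; apply/allP => a /in1 a1 /=.
    by rewrite subr_eq0; apply: contraTneq w1 => ->; rewrite -leNgt.
  by apply: contraNneq => ->.
(* The top coefficients do not cancel, since |c| <= M(f) < |lambda| M(f). So [h] is not constant and
   Gauss-Lucas applies to it. *)
have hs : (h`_(size s)) != 0.
  rewrite coefB (coefZ l) subr_eq0.
  have -> : f`_(size s) = c.
    by rewrite -(lead_coef_poly_roots c s) lead_coefE size_poly_roots.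
  have -> : g`_(size s) = reflect_lead c s.
    rewrite -[RHS](lead_coef_poly_roots _ (map reflect_root s)) lead_coefE.
    by rewrite size_poly_roots// size_map.
  have /lt_eqF/negbT : normc c < normc (l * reflect_lead c s).
    rewrite Normc.normcM normc_reflect_lead.
    rewrite (le_lt_trans (le_root_measure c s))// ltr_pMl//.
    by rewrite -normc_reflect_lead normc_gt0.
  by apply: contraNneq => {1}->.
have [t ht] := poly_roots_exists h.
have hl : lead_coef h != 0.
  by rewrite lead_coef_eq0; apply: contraNneq hs => ->; rewrite coef0.
have : h^`().[z] = 0.
  by rewrite derivB (derivZ l) hornerD hornerN (hornerZ l) /l divfK// subrr.
apply/eqP; rewrite ht; apply: Gauss_Lucas => //.
  apply/eqP => t0; move: hs; rewrite ht t0 /poly_roots big_nil coefZ coef1.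
  by rewrite size_eq0 (negbTE s0) mulr0 eqxx.
move=> a at_; rewrite leNgt; apply/negP => /h_root/eqP; apply.
by rewrite ht horner_poly_roots (big_rem a)//= subrr mul0r mulr0.
Qed.

End RootNorms.

(** * Jensen's formula for a linear factor *)

Section Jensen.
Context {R : realType}.
Local Notation C := R[i].
Local Notation mu := (@lebesgue_measure R).
Implicit Types (u v : R -> R) (a z : C).

Definition mean u : R := \int[mu]_(t in `[0%R, 1%R]) u t.

Lemma continuous_integrable01 u : continuous u ->
  mu.-integrable `[0%R, 1%R] (EFin \o u).
Proof.
move=> cu; apply: continuous_compact_integrable; first exact: segment_compact.
exact: continuous_subspaceT.
Qed.

Lemma meanD u v : continuous u -> continuous v ->
  mean (fun t => u t + v t) = mean u + mean v.
Proof.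
by move=> cu cv; rewrite /mean RintegralD//; exact: continuous_integrable01.
Qed.

Lemma meanZ u r : continuous u -> mean (fun t => r * u t) = r * mean u.
Proof.
by move=> cu; rewrite /mean RintegralZl//; exact: continuous_integrable01.
Qed.

Lemma mean_cst r : mean (cst r) = r.
Proof.
by rewrite /mean Rintegral_cst//= lebesgue_measure_itv/= lte01 oppr0 adde0 mulr1.
Qed.

Lemma eq_mean u v : u =1 v -> mean u = mean v.
Proof. by move=> uv; congr mean; exact/funext. Qed.

Lemma le_mean u v : continuous u -> continuous v -> (forall t, u t <= v t) ->
  mean u <= mean v.
Proof.
by move=> cu cv uv; apply: le_Rintegral => //; exact: continuous_integrable01.
Qed.

Lemma integral_half u c : continuous u ->
  \int[mu]_(t in `[c, (c + 2^-1)%R]) u t = mean (fun t => u (2^-1 * t + c)) / 2.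
Proof.
move=> cu; pose F : R -> R := fun t : R => 2^-1 * t + c.
have dF (t : R) : is_derive t (1 : R) F 2^-1.
  have : is_derive t (1 : R) ((2^-1 : R) \*: (@id R) + cst c) (2^-1 *: 1 + 0).
    exact: _.
  by rewrite addr0 [_ *: _]mulr1.
have F' : F^`() = cst 2^-1.
  by apply/funext => t; rewrite derive1E; exact: derive_val.
have cF : continuous F.
  by move=> t; apply: differentiable_continuous; apply/derivable1_diffP.
have F0 : F 0 = c by rewrite /F mulr0 add0r.
have F1 : F 1 = c + 2^-1 by rewrite /F mulr1 addrC.
have := @integration_by_substitution_increasing R F u 0 1 ler01.
rewrite F0 F1 => sub.
rewrite /Rintegral sub.
- rewrite [RHS]mulrC -meanZ; first by congr fine; apply: eq_integral => t _;
    rewrite F' /= mulrC.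
  by move=> t; apply: continuous_comp; [exact: cF|exact: cu].
- by move=> x y _ _ xy; rewrite /F ltrD2r ltr_pM2l.
- by rewrite F' => ? _; exact: cvg_cst.
- by rewrite F'; exact: is_cvg_cst.
- by rewrite F'; exact: is_cvg_cst.
- split=> /=.
  + by move=> x _; exact: ex_derive.
  + exact/cvg_at_right_filter/cF.
  + exact/cvg_at_left_filter/cF.
- exact: continuous_subspaceT.
Qed.

(** The unit interval is cut at 1/2 and both halves are rescaled. For functions on the circle the
    two integrands then sit at antipodal points, by [expi2pi_half]. *)
Lemma mean_half u : continuous u ->
  mean u = (mean (fun t => u (t / 2)) + mean (fun t => u ((t + 1) / 2))) / 2.
Proof.
move=> cu.
have := @Rintegral_itvB R u (BLeft 0) (BRight 1) 2^-1.
rewrite !bnd_simp -/(mean u) => /(_ (continuous_integrable01 cu)).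
rewrite invr_ge0 ler0n invf_le1 ?ltr0n// ler1n => /(_ isT isT).
rewrite Rintegral_itv_obnd_cbnd; last first.
  apply: (integrableS _ _ _ (continuous_integrable01 cu)) => //.
  apply: subset_itvr; rewrite bnd_simp//.
have := integral_half 0 cu; rewrite add0r => ->.
have half2 : 2^-1 + 2^-1 = 1 :> R by lra.
have := integral_half 2^-1 cu; rewrite half2 => ->.
move=> /eqP; rewrite subr_eq => /eqP ->; rewrite addrC -mulrDl.
congr ((_ + _) / _); apply: eq_mean => t; first by rewrite addr0 mulrC.
by rewrite mulrDl mul1r mulrC.
Qed.

Lemma continuous_compose (f u : R -> R) :
  continuous f -> continuous u -> continuous (fun t => u (f t)).
Proof. by move=> cf cu t; apply: continuous_comp; [exact: cf|exact: cu]. Qed.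

Lemma normc_expi2pi (t : R) : normc (expi2pi t) = 1.
Proof. by rewrite /= cos2Dsin2 sqrtr1. Qed.

Lemma expi2pi_half (t : R) : expi2pi ((t + 1) / 2) = - expi2pi (t / 2) :> C.
Proof.
have -> : expi2pi ((t + 1) / 2) =
    cos (2 * pi * (t / 2) + pi) +i* sin (2 * pi * (t / 2) + pi) :> C.
  by rewrite /expi2pi; congr (cos _ +i* sin _); field.
by rewrite cosDpi sinDpi /expi2pi; apply/eqP; rewrite eq_complex /= !eqxx.
Qed.

Lemma expi2pi_sqr (t : R) : expi2pi (t / 2) ^+ 2 = expi2pi t :> C.
Proof.
have -> : expi2pi t = cos (2 * pi * (t / 2) + 2 * pi * (t / 2)) +i*
    sin (2 * pi * (t / 2) + 2 * pi * (t / 2)) :> C.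
  by rewrite /expi2pi; congr (cos _ +i* sin _); field.
rewrite cosD sinD expr2 /expi2pi.
by apply/eqP; rewrite eq_complex /= eqxx /= addrC mulrC.
Qed.

Definition dist_circle a (t : R) : R := normc (expi2pi t - a).

Lemma continuous_dist_circle a : continuous (dist_circle a).
Proof.
pose f t : R := (cos (2 * pi * t) - complex.Re a) ^+ 2
  + (sin (2 * pi * t) - complex.Im a) ^+ 2.
have -> : dist_circle a = Num.sqrt \o f by apply/funext => t; case: a @f.
suff cf : continuous f.
  by move=> t; apply: continuous_comp; [exact: cf|exact: sqrt_continuous].
move=> t; rewrite /f; apply: cvgD;
  apply: (@cvg_comp _ _ _ _ (fun x : R => x ^+ 2) _ (nbhs _));
  try exact: exprn_continuous; apply: cvgB; try exact: cvg_cst.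
- apply: continuous_comp; last exact: continuous_cos.
  exact: mulrl_continuous.
- apply: continuous_comp; last exact: continuous_sin.
  exact: mulrl_continuous.
Qed.

Lemma ler_normcB z a : normc z - normc a <= normc (z - a).
Proof. by rewrite -lecR rmorphB /= !normc_normr lerB_dist. Qed.

Lemma ler_normcD z a : normc (z - a) <= normc z + normc a.
Proof. by rewrite -lecR rmorphD /= !normc_normr ler_normB. Qed.

Lemma dist_circle_gt0 a t : normc a != 1 -> 0 < dist_circle a t.
Proof.
move=> a1; rewrite normc_gt0 subr_eq0; apply: contraNneq a1 => <-.
by rewrite normc_expi2pi.
Qed.

Lemma continuous_ln_dist a : normc a != 1 ->
  continuous (fun t => ln (dist_circle a t)).
Proof.
move=> a1 t; apply: continuous_comp; first exact: continuous_dist_circle.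
exact/continuous_ln/dist_circle_gt0.
Qed.

(** With w = [expi2pi (t / 2)], the antipodal factors multiply to (w - a) (- w - a) = - (w^2 - a^2),
    and w^2 = [expi2pi t]. *)
Lemma mean_ln_dist_sqr a : normc a != 1 ->
  mean (fun t => ln (dist_circle a t)) =
  mean (fun t => ln (dist_circle (a ^+ 2) t)) / 2.
Proof.
move=> a1; rewrite mean_half; last exact: continuous_ln_dist.
rewrite -meanD.
- congr (_ / _); apply: eq_mean => t.
  rewrite -lnM ?posrE ?dist_circle_gt0// /dist_circle -Normc.normcM.
  rewrite expi2pi_half -(expi2pi_sqr t).
  rewrite -[in RHS]normc_opp; move: (expi2pi _) => e; congr (ln (normc _)).
  by ring.
- apply: (@continuous_compose (fun t => t / 2) (fun t => ln (dist_circle a t)));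
    last exact: continuous_ln_dist.
  exact: mulrr_continuous.
- apply: (@continuous_compose (fun t => (t + 1) / 2) (fun t => ln (dist_circle a t)));
    last exact: continuous_ln_dist.
  apply: (@continuous_compose (fun t => t + 1) (fun t => t / 2)); last exact: mulrr_continuous.
  by move=> t; apply: cvgD; [exact: cvg_id|exact: cvg_cst].
Qed.

Lemma normcX a n : normc (a ^+ n) = normc a ^+ n.
Proof. by elim: n => [|n IH]; rewrite ?Normc.normc1 // !exprS Normc.normcM IH. Qed.

(* Squaring a doubles the mean, which however stays bounded. *)
Lemma mean_ln_dist_lt1 a : normc a < 1 ->
  mean (fun t => ln (dist_circle a t)) = 0.
Proof.
move=> a1; set L := mean _.
(* For |b| <= |a| < 1 the distance from b to a point of the circle lies between 1 - |a| and 2. So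
   [B] serves for all the powers of [a] at once. *)
pose B : R := Num.max (ln 2) (- ln (1 - normc a)).
have bound b : normc b <= normc a -> `|mean (fun t => ln (dist_circle b t))| <= B.
  move=> ba; have b1 := le_lt_trans ba a1.
  have bn1 : normc b != 1 by rewrite lt_eqF.
  have cb := continuous_ln_dist bn1.
  rewrite ler_norml; apply/andP; split.
    rewrite -[leLHS]mean_cst; apply: le_mean => // [|t]; first exact: cst_continuous.
    rewrite /cst /= lerNl le_max lerN2; apply/orP; right.
    rewrite ler_ln ?posrE ?subr_gt0 ?dist_circle_gt0//.
    apply: le_trans (ler_normcB _ _).
    by rewrite normc_expi2pi lerB.
  rewrite -[leRHS]mean_cst; apply: le_mean => // [|t]; first exact: cst_continuous.
  rewrite /cst /= le_max; apply/orP; left.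
  rewrite ler_ln ?posrE ?ltr0n ?dist_circle_gt0//.
  apply: (le_trans (ler_normcD _ _)).
  by rewrite normc_expi2pi -[leRHS]/(1 + 1) lerD2l ltW.
have powle n : normc (a ^+ (2 ^ n)) <= normc a.
  by rewrite normcX ler_iXnr ?expn_gt0 ?normc_ge0// ltW.
have iter n : L = mean (fun t => ln (dist_circle (a ^+ (2 ^ n)) t)) / 2 ^+ n.
  elim: n => [|n ->]; first by rewrite expn0 expr1 divr1.
  rewrite mean_ln_dist_sqr; last by rewrite lt_eqF// (le_lt_trans (powle n)).
  by rewrite -exprM -expnSr -mulrA -invfM -exprS.
apply/eqP/negPn/negP => L0.
have nL : 0 < `|L| by rewrite normr_gt0.
have B0 : 0 <= B / `|L|.
  by rewrite divr_ge0// le_max ln_ge0// ler1n.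
(* This [n] exceeds B / |L|, whereas [iter] and [bound] give n <= 2^n <= B / |L|. *)
have := archi_boundP B0; set n := Num.bound _; apply/negP; rewrite -leNgt.
apply: (@le_trans _ _ (2 ^+ n)).
  by rewrite -natrX ler_nat ltnW// ltn_expl.
rewrite ler_pdivlMr// mulrC.
have := bound _ (powle n).
rewrite (iter n) normrM normfV (ger0_norm (exprn_ge0 _ _))//.
by rewrite divfK // expf_neq0.
Qed.

(** A point outside the disc is reflected: since e e^* = 1 on the circle, |e - a| = |a| |e - 1/a^*|.
    The second factor has logarithmic mean 0, which leaves ln |a|. *)
Lemma mean_ln_dist a : normc a != 1 ->
  mean (fun t => ln (dist_circle a t)) = ln (Num.max 1 (normc a)).
Proof.
move=> a1; case: (leP (normc a) 1) => [ale|agt].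
  by rewrite ln1 mean_ln_dist_lt1// lt_neqAle a1.
have a0 : 0 < normc a by rewrite (lt_trans ltr01 agt).
have ia : normc (a^-1)^* < 1 by rewrite normc_conj normc_inv invf_lt1.
have ia1 : normc (a^-1)^* != 1 by rewrite lt_eqF.
transitivity (mean (fun t => ln (normc a) + ln (dist_circle (a^-1)^* t))).
  apply: eq_mean => t; rewrite -lnM ?posrE ?dist_circle_gt0//; congr ln.
  rewrite /dist_circle -normc_conj rmorphB.
  rewrite -[LHS]mul1r -(normc_expi2pi t) -(normc_conj a) -!Normc.normcM.
  have eK : expi2pi t * (expi2pi t)^* = 1 :> C.
    by rewrite -sqr_normc -normc_normr normc_expi2pi expr1n.
  rewrite -normc_opp fmorphV; move: eK; move: (expi2pi t) => e eK.
  have aC : a^* != 0 by rewrite -normc_gt0 normc_conj.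
  rewrite mulrBr eK mulrBr divff// opprB [in LHS]mulrC.
  by [].
rewrite meanD; [|exact: cst_continuous|exact: continuous_ln_dist].
by rewrite mean_cst mean_ln_dist_lt1// addr0.
Qed.

End Jensen.

(** * Circles of radius larger than 1 *)

Section Circles.
Context {R : realType}.
Local Notation C := R[i].
Local Notation mu := (@lebesgue_measure R).
Implicit Types (a c d z : C) (s : seq C) (r e : R).

Lemma root_measure_cons r c a s :
  root_measure r c (a :: s) = Num.max r (normc a) * root_measure r c s.
Proof. by rewrite /root_measure big_cons mulrCA. Qed.

Lemma root_measure_gt0 r c s : 0 < r -> c != 0 -> 0 < root_measure r c s.
Proof.
move=> r0 c0; elim: s => [|a s IH].
  by rewrite /root_measure big_nil mulr1 normc_gt0.
by rewrite root_measure_cons mulr_gt0// lt_max r0.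
Qed.

Lemma root_measure_ge0 r c s : 0 <= root_measure r c s.
Proof.
elim: s => [|a s IH]; first by rewrite /root_measure big_nil mulr1 normc_ge0.
by rewrite root_measure_cons mulr_ge0// le_max normc_ge0 orbT.
Qed.

Lemma root_measure_le r c s : 1 <= r -> root_measure 1 c s <= root_measure r c s.
Proof.
move=> r1; elim: s => [|a s IH]; first by rewrite /root_measure !big_nil.
rewrite !root_measure_cons ler_pM ?root_measure_ge0//.
  by rewrite le_max ler01.
by rewrite ge_max !le_max r1 lexx !orbT.
Qed.

(** Each root costs one factor [r], because max(r, |a|) <= r max(1, |a|). *)
Lemma root_measure_ler r c s : 1 <= r ->
  root_measure r c s <= r ^+ size s * root_measure 1 c s.
Proof.
move=> r1; elim: s => [|a s IH].
  by rewrite /root_measure !big_nil expr0 mul1r.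
rewrite !root_measure_cons /= exprS mulrACA ler_pM ?root_measure_ge0//.
  by rewrite le_max (le_trans ler01 r1).
rewrite ge_max; apply/andP; split.
  by rewrite ler_peMr ?(le_trans ler01 r1)// le_max lexx.
have [a1|a1] := leP (normc a) 1; first by rewrite mulr1 (le_trans a1).
by rewrite ler_peMl ?normc_ge0.
Qed.

Definition log_circle r c s (t : R) : R :=
  ln (normc (poly_roots c s).[r%:C * expi2pi t]).

Lemma dist_circle_scale r a (t : R) : 0 < r ->
  normc (r%:C * expi2pi t - a) = r * dist_circle (a / r%:C) t.
Proof.
move=> r0; have r0' : r%:C != 0 :> C by rewrite fmorph_eq0 gt_eqF.
transitivity (normc r%:C * dist_circle (a / r%:C) t); last first.
  by rewrite normc_real gtr0_norm.
by rewrite -Normc.normcM; congr normc; rewrite mulrBr mulrCA divff// mulr1.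
Qed.

Lemma normc_div_neq1 r a : 0 < r -> normc a != r -> normc (a / r%:C) != 1.
Proof.
move=> r0; rewrite Normc.normcM normc_inv normc_real gtr0_norm//.
by apply: contra => /eqP h; rewrite -[r]mul1r -h divfK// gt_eqF.
Qed.

Lemma circle_gt0 r c s (t : R) : 0 < r -> c != 0 -> r \notin [seq normc b | b <- s] ->
  0 < normc (poly_roots c s).[r%:C * expi2pi t].
Proof.
move=> r0 c0 rs; rewrite normc_gt0 horner_poly_roots mulf_neq0//.
rewrite prodf_seq_neq0; apply/allP => b bs /=.
rewrite subr_eq0; apply: contra rs => /eqP bE; apply/mapP; exists b => //.
by rewrite -bE Normc.normcM normc_real normc_expi2pi mulr1 gtr0_norm.
Qed.

Lemma log_circle_cons r c a s (x : R) : 0 < r -> c != 0 ->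
  r \notin [seq normc b | b <- a :: s] ->
  log_circle r c (a :: s) x =
  (ln r + ln (dist_circle (a / r%:C) x)) + log_circle r c s x.
Proof.
move=> r0 c0 rs; rewrite /log_circle !horner_poly_roots big_cons mulrCA.
rewrite Normc.normcM dist_circle_scale//.
have ar := normc_div_neq1 r0 (memPn rs _ (mem_head _ _)).
rewrite !lnM ?posrE ?mulr_gt0 ?dist_circle_gt0//.
by rewrite -horner_poly_roots circle_gt0//; case/norP: rs.
Qed.

Lemma continuous_log_circle r c s : 0 < r -> c != 0 -> r \notin [seq normc b | b <- s] ->
  continuous (log_circle r c s).
Proof.
move=> r0 c0; elim: s => [_|a s IH rs].
  have -> : log_circle r c [::] = cst (ln (normc c)).
    by apply/funext => t; rewrite /log_circle horner_poly_roots big_nil mulr1.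
  exact: cst_continuous.
have -> : log_circle r c (a :: s) = (fun t =>
    (ln r + ln (dist_circle (a / r%:C) t)) + log_circle r c s t).
  by apply/funext => t; exact: log_circle_cons.
move=> t; apply: cvgD; last by apply: IH; case/norP: rs.
apply: cvgD; first exact: cvg_cst.
exact/continuous_ln_dist/normc_div_neq1/(memPn rs _ (mem_head _ _)).
Qed.

(** Induction on the roots: |r e - a| = r |e - a/r|, so a root contributes ln r + ln max(1, |a|/r) =
    ln max(r, |a|). With no root on the circle all logarithms are continuous. *)
Lemma Jensen r c s : 0 < r -> c != 0 -> r \notin [seq normc b | b <- s] ->
  mean (log_circle r c s) = ln (root_measure r c s).
Proof.
move=> r0 c0; elim: s => [_|a s IH rs].
  rewrite /root_measure big_nil mulr1 -[RHS]mean_cst; apply: eq_mean => t.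
  by rewrite /log_circle horner_poly_roots big_nil mulr1.
have rs' : r \notin [seq normc b | b <- s] by case/norP: rs.
have ar := normc_div_neq1 r0 (memPn rs _ (mem_head _ _)).
under eq_mean do rewrite log_circle_cons//.
rewrite meanD; [|move=> t; apply: cvgD|exact: continuous_log_circle].
- rewrite meanD; [|exact: cst_continuous|exact: continuous_ln_dist].
  rewrite mean_cst mean_ln_dist// IH// root_measure_cons.
  rewrite [RHS]lnM ?posrE ?root_measure_gt0// ?lt_max ?r0//.
  congr (_ + _); rewrite -lnM ?posrE ?lt_max ?ltr01//; congr ln.
  rewrite maxr_pMr ?ltW// mulr1 Normc.normcM normc_inv normc_real gtr0_norm//.
  by rewrite mulrCA divff ?gt_eqF// mulr1.
- exact: cvg_cst.
- exact: continuous_ln_dist.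
Qed.

Lemma generic_radius (S : seq R) :
  exists2 e, 0 < e & forall r, 1 < r <= 1 + e -> r \notin S.
Proof.
elim: S => [|b S [e e0 IH]]; first by exists 1.
have [b1|b1] := leP b 1.
  exists e => // r re; rewrite inE negb_or IH// andbT.
  by rewrite gt_eqF// (le_lt_trans b1)//; case/andP: re.
(* Half the gap between 1 and [b] keeps the whole interval strictly below [b]. *)
exists (Num.min e ((b - 1) / 2)).
  by rewrite lt_min e0 divr_gt0// subr_gt0.
move=> r /andP[r1 re]; rewrite inE negb_or IH ?andbT.
  rewrite lt_eqF//; apply: (le_lt_trans re); rewrite -ltrBrDl.
  by rewrite gt_min; apply/orP; right; lra.
by rewrite r1 (le_trans re)// lerD2l ge_min lexx.
Qed.

(** Radii in ]1, 1 + e] that tend to 1; [generic_radius] keeps them clear of the roots. *)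
Definition near1 e (n : nat) : R := 1 + e * harmonic n.

Lemma near1_gt1 e n : 0 < e -> 1 < near1 e n.
Proof. by move=> e0; rewrite ltrDl mulr_gt0// harmonic_gt0. Qed.

Lemma near1_le e n : 0 < e -> near1 e n <= 1 + e.
Proof.
move=> e0; rewrite lerD2l ler_piMr ?(ltW e0)//.
by rewrite /harmonic /= invf_le1 ?ltr0n// ler1n.
Qed.

Lemma cvg_near1 e : near1 e n @[n --> \oo] --> (1 : R).
Proof.
rewrite -[X in _ --> X]addr0 -[X in 1 + X](mulr0 e).
by apply: cvgD; [exact: cvg_cst|apply: cvgMr; exact: cvg_harmonic].
Qed.

(** On a generic circle of radius r > 1 Jensen's formula turns the pointwise comparison into one of
    measures. Returning to radius 1 costs at most r to the power [size t], which tends to 1 with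
    r. *)
Lemma root_measure_mono c s d (t : seq C) : c != 0 -> d != 0 ->
  (forall z, 1 < normc z ->
    normc (poly_roots c s).[z] <= normc (poly_roots d t).[z]) ->
  root_measure 1 c s <= root_measure 1 d t.
Proof.
move=> c0 d0 le_cd.
have [e e0 generic] :=
  generic_radius ([seq normc b | b <- s] ++ [seq normc b | b <- t]).
have le n : root_measure 1 c s <= near1 e n ^+ size t * root_measure 1 d t.
  have r1 := near1_gt1 n e0; have r0 := lt_trans ltr01 r1.
  have := generic (near1 e n); rewrite r1 near1_le// => /(_ isT).
  rewrite mem_cat negb_or => /andP[rs rt].
  apply: (le_trans (root_measure_le c s (ltW r1))).
  apply: (le_trans _ (root_measure_ler d t (ltW r1))).
  rewrite -ler_ln ?posrE ?root_measure_gt0// -!Jensen//.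
  apply: le_mean; [exact: continuous_log_circle..|move=> x].
  rewrite ler_ln ?posrE ?circle_gt0// le_cd//.
  by rewrite Normc.normcM normc_real normc_expi2pi mulr1 gtr0_norm.
have cvg : near1 e n ^+ size t * root_measure 1 d t @[n --> \oo] -->
    1 ^+ size t * root_measure 1 d t.
  apply: cvgM; last exact: cvg_cst.
  exact: (cvg_comp (near1 e) _ (@cvg_near1 e) (@exprn_continuous R _ 1)).
rewrite -[leRHS]mul1r -[X in X * _](expr1n _ (size t)).
by apply: (cvgr_to_ge cvg); exact: nearW.
Qed.

End Circles.

(** * The unit circle *)

Section Limit.
Context {R : realType}.
Local Notation C := R[i].
Local Notation mu := (@lebesgue_measure R).
Implicit Types (a c d z : C) (s : seq C) (r e t : R).

(** A positive regularization of |p| at w = [expi2pi t]: for e > 0 it has a finite logarithm even at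
    roots on the circle, it dominates |p((1 + e) w)|, and it decreases to |p(w)| as e tends to 0. *)
Definition majorant c s e t : R :=
  normc c * \prod_(a <- s) (dist_circle a t + e).

Lemma majorant_cons c a s e t :
  majorant c (a :: s) e t = (dist_circle a t + e) * majorant c s e t.
Proof. by rewrite /majorant big_cons mulrCA. Qed.

Lemma majorant0 c s t : majorant c s 0 t = normc (poly_roots c s).[expi2pi t].
Proof.
rewrite horner_poly_roots Normc.normcM normc_prod; congr (_ * _).
by apply: eq_bigr => a _; rewrite addr0.
Qed.

Lemma majorant_gt0 c s e t : c != 0 -> 0 < e -> 0 < majorant c s e t.
Proof.
move=> c0 e0; rewrite mulr_gt0 ?normc_gt0// prodr_gt0// => a _.
by rewrite ltr_wpDl// normc_ge0.
Qed.

Lemma majorant_le c s e e' t : 0 <= e -> e <= e' ->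
  majorant c s e t <= majorant c s e' t.
Proof.
move=> e0 ee'; rewrite ler_wpM2l ?normc_ge0// ler_prod// => a _.
by rewrite addr_ge0 ?normc_ge0//= lerD2l.
Qed.

Lemma majorant_bound c s e t : 0 <= e ->
  majorant c s e t <= normc c * \prod_(a <- s) (1 + normc a + e).
Proof.
move=> e0; rewrite ler_wpM2l ?normc_ge0// ler_prod// => a _.
rewrite addr_ge0 ?normc_ge0//= lerD2r.
by apply: (le_trans (ler_normcD _ _)); rewrite normc_expi2pi.
Qed.

(** In each factor (1 + e) w - a = (w - a) + e w with |w| = 1. *)
Lemma circle_le_majorant c s e t : 0 <= e ->
  normc (poly_roots c s).[(1 + e)%:C * expi2pi t] <= majorant c s e t.
Proof.
move=> e0; rewrite horner_poly_roots Normc.normcM normc_prod.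
rewrite ler_wpM2l ?normc_ge0// ler_prod// => a _; rewrite normc_ge0 /=.
have -> : (1 + e)%:C * expi2pi t - a = (expi2pi t - a) + e%:C * expi2pi t.
  by rewrite rmorphD rmorph1 mulrDl mul1r addrAC.
rewrite -[X in _ + X]opprK; apply: (le_trans (ler_normcD _ _)).
by rewrite lerD2l normc_opp Normc.normcM normc_expi2pi normc_real mulr1 ger0_norm.
Qed.

Lemma continuous_majorant c s e : continuous (majorant c s e).
Proof.
elim: s => [|a s IH].
  have -> : majorant c [::] e = cst (normc c).
    by apply/funext => t; rewrite /majorant big_nil mulr1.
  exact: cst_continuous.
have -> : majorant c (a :: s) e =
    fun t => (dist_circle a t + e) * majorant c s e t.
  by apply/funext => t; rewrite majorant_cons.
move=> t; apply: cvgM; last exact: IH.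
by apply: cvgD; [exact: continuous_dist_circle|exact: cvg_cst].
Qed.

Lemma cvg_majorant c s (u : nat -> R) t : u n @[n --> \oo] --> (0 : R) ->
  majorant c s (u n) t @[n --> \oo] --> majorant c s 0 t.
Proof.
move=> u0; elim: s => [|a s IH].
  under eq_fun do rewrite /majorant big_nil.
  by rewrite /majorant big_nil; exact: cvg_cst.
under eq_fun do rewrite majorant_cons.
rewrite majorant_cons; apply: cvgM => //.
by apply: cvgD => //; exact: cvg_cst.
Qed.

(** The limit x = 0 is included: the logarithms then tend to -oo, the value of [lne] at 0. This is
    what happens at roots on the circle. *)
Lemma cvg_lne (u : nat -> R) (x : R) : (forall n, 0 < u n) ->
  u n @[n --> \oo] --> x -> (ln (u n))%:E @[n --> \oo] --> lne x%:E.
Proof.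
move=> u0 ux.
have x0 : 0 <= x by apply: (cvgr_to_ge ux); apply: nearW => n; exact: ltW.
move: x0; rewrite le_eqVlt => /predU1P[x0|x0]; last first.
  rewrite lne_EFin//; apply: cvg_EFin; first exact: nearW.
  by apply: (cvg_comp _ _ ux); exact: continuous_ln.
rewrite -x0 le0_lneNy//; apply/cvgeNyPle => A.
have : \forall n \near \oo, u n <= expR A.
  by apply: (cvgr_le x ux); rewrite -x0 expR_gt0.
apply: filterS => n un; rewrite lee_fin.
by rewrite -ler_expR lnK// posrE.
Qed.

(** Since ln |p| can be -oo, the limit is taken by monotone convergence: the functions K - ln
    [majorant] are nonnegative and increase to K - ln |p|. Jensen's formula on circles shrinking to
    radius 1 bounds their integrals by K - ln M(p). *)
Lemma root_measure_le_integral c s : c != 0 ->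
  ((ln (root_measure 1 c s))%:E <= \int[mu]_(t in `[0%R, 1%R])
     lne (normc (poly_roots c s).[expi2pi t])%:E)%E.
Proof.
move=> c0.
have [e e0 generic] := generic_radius [seq normc a | a <- s].
(* An upper bound for the logarithms of all the majorants used, as [d n <= e]; it makes [g n]
   nonnegative. *)
pose K : R := ln (normc c * \prod_(a <- s) (1 + normc a + e)).
pose d n : R := e * harmonic n.
have d0 n : 0 < d n by rewrite mulr_gt0// harmonic_gt0.
have de n : d n <= e by rewrite -(lerD2l 1); exact: near1_le.
have ln_cont n : continuous (fun t => ln (majorant c s (d n) t)).
  move=> t; apply: continuous_comp; first exact: continuous_majorant.
  exact/continuous_ln/majorant_gt0.
pose g n t : R := K - ln (majorant c s (d n) t).
have cg n : continuous (g n).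
  by move=> t; apply: cvgB; [exact: cvg_cst|exact: ln_cont].
have g0 n t : 0 <= g n t.
  rewrite subr_ge0 ler_ln ?posrE ?majorant_gt0//.
    apply: (le_trans (majorant_le _ _ _ (ltW (d0 n)) (de n))).
    exact/majorant_bound/ltW.
  rewrite mulr_gt0 ?normc_gt0// prodr_gt0// => a _.
  by rewrite ltr_wpDl// addr_ge0// normc_ge0.
pose G t : \bar R := (K%:E - lne (normc (poly_roots c s).[expi2pi t])%:E)%E.
have gG t : (g n t)%:E @[n --> \oo] --> G t.
  rewrite /G /g; under eq_fun do rewrite EFinB.
  rewrite -majorant0; apply: cvgeB => //; first exact: cvg_cst.
  apply: cvg_lne => [n|]; first exact: majorant_gt0.
  apply: cvg_majorant; rewrite -(mulr0 e).
  by apply: cvgMr; exact: cvg_harmonic.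
have int_g n : (\int[mu]_(t in `[0%R, 1%R]) (g n t)%:E <=
    (K - ln (root_measure 1 c s))%:E)%E.
  have -> : (\int[mu]_(t in `[0%R, 1%R]) (g n t)%:E)%E = (mean (g n))%:E.
    rewrite /mean /Rintegral fineK//.
    apply: integrable_fin_num => //; exact: continuous_integrable01.
  rewrite lee_fin.
  have -> : mean (g n) = K - mean (fun t => ln (majorant c s (d n) t)).
    rewrite -[K in RHS]mean_cst -[X in _ - X]mul1r -mulN1r mulrA mulr1.
    rewrite -meanZ// -meanD//; first by apply: eq_mean => t; rewrite mulN1r.
      exact: cst_continuous.
    by move=> t; apply: cvgM; [exact: cvg_cst|exact: ln_cont].
  rewrite lerB//.
  have r1 := near1_gt1 n e0; have r0 := lt_trans ltr01 r1.
  have rs : near1 e n \notin [seq normc a | a <- s].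
    by apply: generic; rewrite r1 near1_le.
  (* Jensen's formula is applied on the generic radius [near1 e n]; going down to radius 1 can only
     lower the measure. *)
  apply: (@le_trans _ _ (ln (root_measure (near1 e n) c s))).
    rewrite ler_ln ?posrE ?root_measure_gt0//.
    exact/root_measure_le/ltW.
  rewrite -Jensen//; apply: le_mean => // [|t]; first exact: continuous_log_circle.
  rewrite ler_ln ?posrE ?majorant_gt0 ?circle_gt0//.
  exact: circle_le_majorant (ltW (d0 n)).
have mg n : measurable_fun (`[0%R, 1%R] : set R) (fun t => (g n t)%:E).
  apply/measurable_EFinP; apply: measurable_funTS.
  exact: continuous_measurable_fun.
have mG : measurable_fun (`[0%R, 1%R] : set R) G.
  by apply: (emeasurable_fun_cvg (fun n t => (g n t)%:E)) => // t _; exact: gG.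
have limG t : limn (fun n => (g n t)%:E) = G t by apply/cvg_lim.
have G0 t : (0 <= G t)%E.
  rewrite -limG; apply: lime_ge; first by apply/cvg_ex; exists (G t); exact: gG.
  by apply: nearW => n; rewrite lee_fin.
have int_G : (\int[mu]_(t in `[0%R, 1%R]) G t <=
    (K - ln (root_measure 1 c s))%:E)%E.
  have : (\int[mu]_(t in `[0%R, 1%R]) (g n t)%:E @[n --> \oo] -->
      \int[mu]_(t in `[0%R, 1%R]) G t)%E.
    under [X in _ --> X]eq_integral do rewrite -limG.
    apply: cvg_monotone_convergence => // [n t _|t _ m n mn].
      by rewrite lee_fin.
    rewrite lee_fin lerB// ler_ln ?posrE ?majorant_gt0//.
    apply: majorant_le; first exact: ltW.
    by rewrite ler_pM2l// lef_pV2 ?posrE ?ltr0n// ler_nat.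
  by move/cvge_to_le; apply; exact: nearW.
(* Integrability of [G] allows the integral of ln |p| to be written as K minus the integral of [G],
   the interval having length 1. *)
have iG : mu.-integrable `[0%R, 1%R] G.
  apply/integrableP; split => //.
  under eq_integral do rewrite gee0_abs//.
  exact: (le_lt_trans int_G (ltry _)).
have -> : (\int[mu]_(t in `[0%R, 1%R])
     lne (normc (poly_roots c s).[expi2pi t])%:E =
   \int[mu]_(t in `[0%R, 1%R]) (cst K%:E t - G t))%E.
  by apply: eq_integral => t _; rewrite /G oppeB//= addeA subee// add0e.
rewrite integralB//=; last first.
  exact: (continuous_integrable01 (@cst_continuous _ _ K)).
have -> : (\int[mu]_(t in `[0%R, 1%R]) K%:E)%E = K%:E.
  by rewrite integral_cst//= lebesgue_measure_itv/= lte01 oppr0 adde0 mule1.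
rewrite leeBrDr ?integrable_fin_num//.
apply: (le_trans (leeD2l _ int_G)).
by rewrite -EFinD addrC subrK.
Qed.

End Limit.

(** * Polynomials with few terms *)

Section Sparse.
Context {R : realType}.
Local Notation C := R[i].
Implicit Types (a c d z : C) (s t : seq C) (p : {poly C}).

Lemma coef_deriv_poly_roots c s :
  (poly_roots c s)^`()%R`_(size s).-1 = c *+ size s.
Proof.
case: (eqVneq c 0) => [->|c0].
  by rewrite /poly_roots scale0r deriv0 coef0 mul0rn.
case: s => [|a s].
  by rewrite /poly_roots big_nil derivZ derivC scaler0 coef0 mulr0n.
rewrite coef_deriv; congr (_ *+ _).
by rewrite -[RHS](lead_coef_poly_roots c (a :: s)) lead_coefE size_poly_roots.
Qed.

(** In characteristic 0 the coefficient [c *+ size s] does not vanish, so the degree drops by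
    exactly one. *)
Lemma deriv_poly_roots_exists c s : c != 0 -> s != [::] ->
  exists2 t, (poly_roots c s)^`()%R = poly_roots (c *+ size s) t
           & size s = (size t).+1.
Proof.
move=> c0 s0; have [t pt] := poly_roots_exists (poly_roots c s)^`()%R.
have cs0 : c *+ size s != 0 by rewrite mulrn_eq0 negb_or size_eq0 s0.
have le1 : (size (poly_roots c s)^`()%R <= size s)%N.
  by rewrite -ltnS -(size_poly_roots s c0) lt_size_deriv// -size_poly_gt0 size_poly_roots.
have szE : size (poly_roots c s)^`()%R = size s.
  apply/eqP; rewrite eqn_leq le1 leqNgt; apply/negP => lt.
  move: cs0; rewrite -coef_deriv_poly_roots nth_default ?eqxx//.
  by case: s s0 lt {le1 pt} => //= a s _; rewrite ltnS.
have lE : lead_coef (poly_roots c s)^`()%R = c *+ size s.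
  by rewrite lead_coefE szE coef_deriv_poly_roots.
exists t; first by rewrite -lE.
by rewrite -szE {1}pt size_poly_roots// lE.
Qed.

Lemma root_measure_disc c s : {in s, forall a, normc a <= 1} ->
  root_measure 1 c s = normc c.
Proof.
move=> s1; rewrite /root_measure big_seq big1 ?mulr1// => a /s1 a1.
by apply/max_idPl.
Qed.

(** Outside the disc |p'| is at most |g'|, where g is p with its outer roots reflected. By
    Gauss-Lucas the roots of g' lie in the disc, so M(g') is just the modulus of its leading
    coefficient, deg(p) M(p). *)
Lemma root_measure_deriv c s d t : c != 0 -> s != [::] -> d != 0 ->
  (poly_roots c s)^`()%R = poly_roots d t ->
  root_measure 1 d t <= (size s)%:R * root_measure 1 c s.
Proof.
move=> c0 s0 d0 pt.
have g0 : reflect_lead c s != 0.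
  rewrite -normc_gt0 normc_reflect_lead.
  by rewrite (lt_le_trans _ (le_root_measure _ _)) ?normc_gt0.
have in1 : {in [seq reflect_root a | a <- s], forall a, normc a <= 1}.
  by move=> _ /mapP[a _ ->]; exact: normc_reflect_root.
have rs0 : [seq reflect_root a | a <- s] != [::] by case: (s) s0.
have [u gu _] := deriv_poly_roots_exists g0 rs0.
have cs0 : reflect_lead c s *+ size [seq reflect_root a | a <- s] != 0.
  by rewrite mulrn_eq0 negb_or size_eq0 rs0.
apply: (@le_trans _ _ (root_measure 1 (reflect_lead c s *+
    size [seq reflect_root a | a <- s]) u)).
  apply: root_measure_mono => // z z1.
  by rewrite -gu -pt; exact: deriv_reflect_le.
rewrite root_measure_disc; last first.
  move=> a au; rewrite leNgt; apply/negP => /(Gauss_Lucas g0 rs0 in1)/eqP; apply.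
  by rewrite gu horner_poly_roots (big_rem a)//= subrr mul0r mulr0.
by rewrite size_map -mulr_natl Normc.normcM normc_natr normc_reflect_lead.
Qed.

(** For p of degree at most n this is X^n p(1/X). *)
Definition reversal n p : {poly C} := \poly_(i < n.+1) p`_(n - i).

Lemma reversal_prod_XsubC s :
  reversal (size s) (\prod_(a <- s) ('X - a%:P)) = \prod_(a <- s) (1 - a *: 'X).
Proof.
elim: s => [|a s IH].
  rewrite !big_nil; apply/polyP => -[|i]; rewrite coef_poly !coef1//.
rewrite !big_cons -IH; apply/polyP => i.
rewrite [in RHS]mulrBl mul1r -scalerAl [RHS]coefB coefZ coefXM !coef_poly /=.
rewrite mulrBl coefB coefXM mul_polyC coefZ.
have big j : (size s < j)%N -> (\prod_(b <- s) ('X - b%:P))`_j = 0 :> C.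
  by move=> js; rewrite nth_default// size_prod_XsubC.
move: (\prod_(b <- s) _) (size s) big => p n big.
case: i => [|i] /=; first by rewrite !subn0 (big n.+1)// !mulr0.
rewrite !ltnS subSS; case: (ltngtP i n) => [i_n|n_i|->].
- by rewrite subn_eq0 leqNgt i_n /= -subnS.
- by rewrite mulr0 subr0.
- by rewrite subnn.
Qed.

(** Reversal turns X - a into 1 - a X = - a (X - 1/a), factor by factor. *)
Lemma reversal_poly_roots c s : 0 \notin s ->
  reversal (size s) (poly_roots c s) =
  poly_roots (c * \prod_(a <- s) - a) [seq a^-1 | a <- s].
Proof.
move=> s0; rewrite /poly_roots big_map -scalerA.
have -> : reversal (size s) (c *: \prod_(a <- s) ('X - a%:P)) =
    c *: reversal (size s) (\prod_(a <- s) ('X - a%:P)).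
  apply/polyP => i; rewrite coefZ !coef_poly coefZ.
  by case: ifP; rewrite ?mulr0.
rewrite reversal_prod_XsubC; congr (_ *: _).
elim: s s0 => [|a s IH]; first by rewrite !big_nil scale1r.
rewrite inE negb_or eq_sym => /andP[a0 /IH {}IH].
rewrite !big_cons IH -scalerAr [- a * _]mulrC -scalerA; congr (_ *: _).
rewrite scalerAl; congr (_ * _).
rewrite scalerBr -[- a *: _%:P]mul_polyC -polyCM mulNr divff// polyCN opprK.
by rewrite scaleNr addrC.
Qed.

(** For each root, |a| max(1, 1/|a|) = max(1, |a|). *)
Lemma root_measure_reversal c s : 0 \notin s ->
  root_measure 1 (c * \prod_(a <- s) - a) [seq a^-1 | a <- s] =
  root_measure 1 c s.
Proof.
elim: s => [|a s IH]; first by rewrite /root_measure /= !big_nil !mulr1.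
rewrite inE negb_or eq_sym => /andP[a0 /IH {}IH].
rewrite [RHS]root_measure_cons -IH /= /root_measure !big_cons !Normc.normcM.
rewrite normc_opp normc_inv.
have na : 0 < normc a by rewrite normc_gt0.
suff <- : normc a * Num.max 1 (normc a)^-1 = Num.max 1 (normc a) by ring.
by rewrite maxr_pMr ?ltW// mulr1 divff ?gt_eqF// maxC.
Qed.

Definition nterms n p : nat := (\sum_(i < n) (p`_i != 0)%R)%N.

Lemma nterms_reversal n p : nterms n.+1 (reversal n p) = nterms n.+1 p.
Proof.
rewrite /nterms (reindex_inj rev_ord_inj) /=; apply: eq_bigr => i _.
rewrite coef_poly /= subSS ltnS leq_subr subKn//.
by rewrite -ltnS.
Qed.

Lemma nterms_deriv n p : nterms n.+1 p = ((p`_0 != 0)%R + nterms n p^`()%R)%N.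
Proof.
rewrite /nterms big_ord_recl; congr (_ + _)%N; apply: eq_bigr => i _.
by rewrite coef_deriv mulrn_eq0.
Qed.

Lemma nterms_mulX n p : nterms n.+1 ('X * p) = nterms n p.
Proof.
rewrite /nterms big_ord_recl coefXM eqxx add0n; apply: eq_bigr => i _.
by rewrite coefXM.
Qed.

Lemma nterms_eq0 n p : (size p <= n)%N -> nterms n p = 0%N -> p = 0.
Proof.
move=> pn /eqP; rewrite sum_nat_eq0 => /forallP p0.
apply/polyP => i; rewrite coef0; have [ni|i_n] := leqP n i.
  by rewrite nth_default// (leq_trans pn).
by have := p0 (Ordinal i_n); rewrite /= eqb0 negbK => /eqP.
Qed.

Lemma poly_roots_coef0_neq0 c s : c != 0 -> ((poly_roots c s)`_0 != 0) = (0 \notin s).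
Proof.
move=> c0; rewrite -horner_coef0 horner_poly_roots mulf_eq0 (negbTE c0) /=.
rewrite prodf_seq_eq0; congr (~~ _); apply/hasP/idP => [[a a_s]|s0].
  by rewrite sub0r oppr_eq0 => /eqP <-.
by exists 0 => //=; rewrite subr0.
Qed.

(** Named as a predicate of [k] so that [upper_half_bound] can take the induction hypothesis as an
    assumption. *)
Definition sparse_bound k := forall c s i, c != 0 ->
  (nterms (size s).+1 (poly_roots c s) <= k.+1)%N ->
  normc (poly_roots c s)`_i <= 2 ^+ k * root_measure 1 c s.

(* Differentiating kills the constant term and multiplies the coefficient of
   degree i by i, which is at least half the degree of the polynomial. *)
Lemma upper_half_bound k c s i : (forall j, (j < k)%N -> sparse_bound j) ->
  c != 0 -> s != [::] -> 0 \notin s ->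
  (nterms (size s).+1 (poly_roots c s) <= k.+1)%N -> (size s <= i.*2)%N ->
  normc (poly_roots c s)`_i <= 2 ^+ k * root_measure 1 c s.
Proof.
move=> IH c0 s0 sn0.
rewrite nterms_deriv poly_roots_coef0_neq0// sn0 add1n ltnS => nk si.
have [t dt st] := deriv_poly_roots_exists c0 s0.
have cs0 : c *+ size s != 0 by rewrite mulrn_eq0 negb_or size_eq0 s0.
have szt : size (poly_roots (c *+ size s) t) = size s by rewrite size_poly_roots.
case: k IH nk => [IH|k IH nk].
  (* The only term would be the nonzero constant one, so p' would be 0 although [s] is nonempty. *)
  rewrite leqn0 => /eqP/nterms_eq0; rewrite dt szt leqnn => /(_ isT)/eqP.
  by rewrite -size_poly_eq0 szt st.
have i0 : (0 < i)%N by case: i si => //; rewrite double0 leqn0 size_eq0 (negbTE s0).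
have := IH k (ltnSn k) (c *+ size s) t i.-1 cs0.
rewrite -st -dt coef_deriv prednK// => /(_ nk).
rewrite -[_`_i *+ i]mulr_natl Normc.normcM normc_natr => le1.
(* Together: i |p_i| <= 2^k M(p') <= 2^k deg(p) M(p) <= 2^k (2 i) M(p), and [i] cancels. *)
have le2 := root_measure_deriv c0 s0 cs0 dt.
have iR : 0 < i%:R :> R by rewrite ltr0n.
rewrite -(ler_pM2l iR) (le_trans le1)//.
have -> : i%:R * (2 ^+ k.+1 * root_measure 1 c s) =
    2 ^+ k * (i.*2%:R * root_measure 1 c s).
  by rewrite exprS -muln2 natrM; ring.
rewrite ler_pM2l ?exprn_gt0// (le_trans le2)//.
by rewrite ler_wpM2r ?root_measure_ge0// ler_nat.
Qed.

Lemma sparse_boundP k : sparse_bound k.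
Proof.
elim/ltn_ind: k => k IHk c s i c0.
(* The inner induction on the number of roots serves the case of a root 0, where the number of terms
   stays the same. *)
have [n] := ubnP (size s); elim: n s i => // n IHn s i; rewrite ltnS => sn nk.
have k1 : 1 <= 2 ^+ k :> R by rewrite exprn_ege1// ler1n.
have [s0|s0] := boolP (0 \in s).
  (* Dividing out X shifts the coefficients by one and keeps the measure, since max(1, 0) = 1. *)
  have pE : poly_roots c s = 'X * poly_roots c (rem 0 s).
    by rewrite /poly_roots (big_rem 0)//= subr0 scalerAr.
  have mE : root_measure 1 c s = root_measure 1 c (rem 0 s).
    rewrite /root_measure (big_rem 0)// Normc.normc0.
    by rewrite max_l ?ler01//= mul1r.
  have szE : size s = (size (rem 0 s)).+1.
    by rewrite size_rem// prednK//; case: (s) s0.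
  move: nk; rewrite szE pE nterms_mulX mE coefXM => nk.
  case: i => [|i].
    by rewrite eqxx Normc.normc0 mulr_ge0 ?root_measure_ge0// (le_trans ler01).
  by apply: IHn => //; rewrite -szE.
have [sE|sn0] := eqVneq s [::].
  apply: (@le_trans _ _ (normc c)).
    rewrite sE /poly_roots big_nil coefZ coef1 Normc.normcM normc_natr.
    by case: (i == 0)%N; rewrite ?mulr1 ?mulr0 ?normc_ge0.
  by rewrite (le_trans (le_root_measure c s))// ler_peMl// root_measure_ge0.
have [si|si] := leqP (size s) i.*2; first exact: upper_half_bound.
(* Below half the degree the reversed polynomial is used: it has the same measure and number of
   terms, and the coefficient moves to degree [size s - i]. *)
have i_s : (i <= size s)%N by lia.
rewrite -(root_measure_reversal c s0).
have -> : (poly_roots c s)`_i =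
    (poly_roots (c * \prod_(a <- s) - a) [seq a^-1 | a <- s])`_(size s - i).
  by rewrite -reversal_poly_roots// coef_poly ltnS leq_subr subKn.
apply: upper_half_bound => //.
- rewrite mulf_neq0// prodf_seq_neq0; apply/allP => a a_s /=.
  by rewrite oppr_eq0; apply: contraNneq s0 => <-.
- by case: (s) sn0.
- by apply: contra s0 => /mapP[a a_s /esym/eqP]; rewrite invr_eq0 => /eqP <-.
- by rewrite size_map -reversal_poly_roots// nterms_reversal.
- by rewrite size_map; lia.
Qed.

End Sparse.

(** * Laurent polynomials *)

Section Laurent.
Context {R : realType}.
Local Notation C := R[i].
Implicit Types (p q : {poly C}) (m : nat).

Lemma mahler_coef_bound p k i : (nterms (size p) p <= k.+1)%N ->
  mahler (horner p) = 1%E -> normc p`_i <= 2 ^+ k.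
Proof.
move=> nk Mp; have [->|p0] := eqVneq p 0.
  by rewrite coef0 Normc.normc0 exprn_ge0.
have [s ps] := poly_roots_exists p; move: nk Mp; rewrite ps.
have c0 : lead_coef p != 0 by rewrite lead_coef_eq0.
move: (lead_coef p) c0 => c c0; rewrite size_poly_roots// => nk Mp.
apply: (le_trans (sparse_boundP i c0 nk)); rewrite ler_piMr ?exprn_ge0//.
have := root_measure_le_integral s c0.
(* Measure 1 means that the integral is 0, whence ln M(p) <= 0. *)
move/(congr1 (@lne R)) : Mp; rewrite /mahler expeRK lne1 => ->.
by rewrite lee_fin -[X in _ <= X]ln1 ler_ln ?posrE ?root_measure_gt0.
Qed.

Lemma ntermsD m p q : (nterms m (p + q) <= nterms m p + nterms m q)%N.
Proof.
rewrite /nterms -big_split /=; apply: leq_sum => i _; rewrite coefD.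
by case: eqVneq => // pq; case: eqVneq => [p0|]; case: eqVneq => [q0|] //;
  rewrite p0 q0 addr0 eqxx in pq.
Qed.

Lemma nterms_monomial m (c : C) e : (nterms m (c *: 'X^e) <= 1)%N.
Proof.
rewrite /nterms; have [em|em] := ltnP e m; last first.
  rewrite big1// => i _; rewrite coefZ coefXn.
  by rewrite (ltn_eqF (leq_trans (ltn_ord i) em)) /= mulr0 eqxx.
rewrite (bigD1 (Ordinal em))//= big1 ?addn0 ?leq_b1// => i ie.
rewrite coefZ coefXn; case: (eqVneq (i : nat) e) => [ieq|_]; last by rewrite mulr0 eqxx.
by case/eqP: ie; exact: val_inj.
Qed.

Lemma nterms_sum m k (F : 'I_k -> {poly C}) :
  (forall i, (nterms m (F i) <= 1)%N) -> (nterms m (\sum_(i < k) F i) <= k)%N.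
Proof.
move=> F1; elim: k F F1 => [|k IH] F F1.
  by rewrite big_ord0 /nterms big1// => i _; rewrite coef0 eqxx.
rewrite big_ord_recr (leq_trans (ntermsD _ _ _))//= -[leqRHS]addn1 leq_add//.
exact: IH.
Qed.

Variables (k : nat) (a : k.-tuple int) (n : k.-1.-tuple int).

(** The sum dominates every |n_i|, so multiplication by this power of X clears all negative
    exponents. *)
Definition shift : nat := (\sum_(i < k.-1) absz (n`_i)%R)%N.

Definition laurent_poly : {poly C} :=
  (\sum_(i < k.-1) (a`_i)%:~R *: 'X^(absz (n`_i + shift%:Z)%R)) +
  (a`_k.-1)%:~R *: 'X^shift.

Lemma shift_ge0 (i : 'I_k.-1) : 0 <= n`_i + shift%:Z.
Proof.
have : (absz (n`_i)%R <= shift)%N by rewrite /shift (bigD1 i)//= leq_addr.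
by lia.
Qed.

Lemma horner_laurent_poly (z : C) : z != 0 ->
  laurent_poly.[z] = z ^+ shift * laurent a n z.
Proof.
move=> z0; rewrite /laurent_poly /laurent hornerD horner_sum hornerZ hornerXn.
rewrite mulrDr mulr_sumr [_ * z ^+ _]mulrC; congr (_ + _).
apply: eq_bigr => i _; rewrite hornerZ hornerXn mulrCA; congr (_ * _).
by rewrite exprnP gez0_abs ?shift_ge0// addrC expfzDr// exprnP.
Qed.

(** Powers of z have modulus 1 on the unit circle. *)
Lemma mahler_laurent_poly :
  mahler (laurent a n : C -> C) = mahler (horner laurent_poly).
Proof.
congr expeR; apply: eq_integral => t _; congr (lne _%:E).
have e0 : expi2pi t != 0 :> C by rewrite -normc_gt0 normc_expi2pi.
by rewrite horner_laurent_poly// Normc.normcM normcX normc_expi2pi expr1n mul1r.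
Qed.

Lemma nterms_laurent_poly m : (1 <= k)%N -> (nterms m laurent_poly <= k)%N.
Proof.
move=> k1; rewrite -[leqRHS](prednK k1) -addn1.
rewrite (leq_trans (ntermsD _ _ _))// leq_add ?nterms_monomial//.
by apply: nterms_sum => i; exact: nterms_monomial.
Qed.

(** The exponents are distinct and differ from that of the constant term, so no two monomials merge.
    The last entry of [a] sits in degree [shift]. *)
Lemma coef_laurent_poly i : uniq n -> 0 \notin n -> (i < k)%N ->
  exists e, laurent_poly`_e = (a`_i)%:~R.
Proof.
move=> un n0 ik.
have [ik1|ik1] := ltnP i k.-1; last first.
  have -> : i = k.-1 by lia.
  exists shift; rewrite coefD coefZ coefXn eqxx mulr1 coef_sum big1 ?add0r// => j _.
  rewrite coefZ coefXn.
  have jn : n`_j \in (n : seq _) by rewrite mem_nth ?size_tuple.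
  have nj0 : n`_j != 0 by apply: contraNneq n0 => <-.
  have -> : (shift == absz (n`_j + shift%:Z)%R) = false by have := shift_ge0 j; lia.
  by rewrite /= mulr0.
pose i' := Ordinal ik1.
exists (absz (n`_i + shift%:Z)%R); have ni : 0 <= n`_i + shift%:Z := shift_ge0 i'.
rewrite coefD coefZ coefXn.
have jn : n`_i \in (n : seq _) by rewrite mem_nth ?size_tuple.
have nj0 : n`_i != 0 by apply: contraNneq n0 => <-.
have -> : (absz (n`_i + shift%:Z)%R == shift) = false by lia.
rewrite /= mulr0 addr0 coef_sum (bigD1 i')//= coefZ coefXn eqxx mulr1.
rewrite big1 ?addr0// => j ji; rewrite coefZ coefXn.
have nij : n`_i != n`_j.
  by rewrite nth_uniq ?size_tuple//; apply: contra ji => /eqP h; apply/eqP/val_inj.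
(* Both shifted exponents are nonnegative, so taking [absz] cannot identify them. *)
have -> : (absz (n`_i + shift%:Z)%R == absz (n`_j + shift%:Z)%R) = false.
  by have := shift_ge0 j; lia.
by rewrite /= mulr0.
Qed.

End Laurent.

Lemma finite_bounded_tuples k (B : nat) :
  finite_set [set a : k.-tuple int | forall i, (i < k)%N -> (absz (a`_i)%R <= B)%N].
Proof.
(* The values of [f] are the integers from -B to B, so the set lies in the image of a finite type of
   tuples. *)
pose f (j : 'I_(B.*2.+1)) : int := j%:Z - B%:Z.
apply: (@sub_finite_set _ _ (range (map_tuple f : k.-tuple _ -> k.-tuple int))).
  move=> a aB; exists [tuple inord (absz (tnth a i + B%:Z)%R) | i < k] => //.
  apply: eq_from_tnth => i; rewrite tnth_map tnth_mktuple /f.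
  have := aB i (ltn_ord i); rewrite -tnth_nth => ai.
  by move: (tnth a i) ai => x xB; rewrite inordK; lia.
by apply: finite_image; exact: finite_finset.
Qed.

Theorem corollary1 (R : realType) (k : nat) (k_ge1 : (1 <= k)%N) :
  finite_set [set a : k.-tuple int |
    exists n : k.-1.-tuple int,
      [/\ uniq n,
          0 \notin n,
          (exists z : R[i], z != 0 /\ laurent a n z != 0)
        & mahler (laurent a n : R[i] -> R[i]) = 1%E]].
Proof.
(* There are at most [k] terms, that is [k.-1.+1], so [mahler_coef_bound] gives the exponent
   [k.-1]. *)
apply: sub_finite_set (finite_bounded_tuples k (2 ^ k.-1)).
move=> a [n [un n0 _ Ma]] i ik.
have [e ae] := @coef_laurent_poly R k a n i un n0 ik.
have := @mahler_coef_bound R (laurent_poly a n) k.-1 e.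
rewrite prednK// nterms_laurent_poly// -mahler_laurent_poly ae.
move=> /(_ isT Ma).
rewrite -(rmorph_int (real_complex R)) normc_real -intr_norm.
rewrite -abszE -natrX.
by rewrite -[_%:~R]/((absz (a`_i)%R%N)%:R) ler_nat.
Qed.
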